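(* Let $\mathcal V$ be an ai-semiring variety and let $\mathcal V_r=\mathscr M_r(\mathcal V)$ for $r\ge1$. If $\mathcal V_p=\mathcal V_q$ for some $1\le p<q$, then the chain $(\mathcal V_r)_{r\ge1}$ is eventually constant. More precisely, if $$r_0=\left\lceil\frac{p}{q-p}\right\rceil,$$ then $\mathcal V_s=\mathcal V_t$ for all $s,t\ge r_0p$.
   Context: An additively idempotent semiring (ai-semiring) is an algebra $(S,+,\cdot)$ in the signature of two binary operations with $(S,+)$ a commutative idempotent semigroup, $(S,\cdot)$ a semigroup, and multiplication distributing over addition on both sides. For an ai-semiring $S$ and $n\ge1$, $M_n(S)$ is the ai-semiring of all $n\times n$ matrices over $S$ with entrywise addition and usual matrix multiplication. For an ai-semiring variety $\mathcal V$ and $n\ge1$, $\mathscr M_n(\mathcal V)$ is the variety generated by $\{M_n(S):S\in\mathcal V\}$. *)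

(* Defs.v *)
From HB Require Import structures.
From mathcomp Require Import all_boot all_algebra.
From mathcomp Require Import boolp.

Set Implicit Arguments.
Unset Strict Implicit.
Unset Printing Implicit Defensive.

Declare Scope ai_scope.
Delimit Scope ai_scope with ai.
Local Open Scope ai_scope.

(* The library's semirings have a zero and its additive and multiplicative    *)
(* semigroups are choice types, hence a separate structure. As usual in       *)
(* universal algebra, carriers are nonempty.                                  *)
HB.mixin Record isAiSemiring T := {
  ai_nonempty : inhabited T;
  ai_add : T -> T -> T;
  ai_mul : T -> T -> T;
  ai_addA : associative ai_add;
  ai_addC : commutative ai_add;
  ai_addxx : idempotent_op ai_add;
  ai_mulA : associative ai_mul;
  ai_mulDl : left_distributive ai_mul ai_add;
  ai_mulDr : right_distributive ai_mul ai_add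
}.

#[short(type="aiSemiringType")]
HB.structure Definition AiSemiring := {T of isAiSemiring T}.

Bind Scope ai_scope with AiSemiring.sort.
Notation "x + y" := (ai_add x y) : ai_scope.
Notation "x * y" := (ai_mul x y) : ai_scope.

Definition ai_hom (S T : aiSemiringType) (f : S -> T) : Prop :=
  {morph f : x y / x + y} /\ {morph f : x y / x * y}.

Section Matrix.
Variables (n : nat) (S : aiSemiringType).
Implicit Types A B C : 'M[S]_n.

Definition ai_addmx A B : 'M[S]_n := \matrix_(i, j) (A i j + B i j).

(* The sum of A i k * B k j over all k < n. A semiring without zero has no    *)
(* empty sum, so the iteration starts from the term k = i instead.            *)
Definition ai_mulmx A B : 'M[S]_n :=
  \matrix_(i, j) \big[@ai_add S/A i i * B i j]_(k < n | k != i) (A i k * B k j).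

Let le (x z : S) := x + z = z.

Let le_add x y z : le (x + y) z <-> le x z /\ le y z.
Proof.
rewrite /le; split=> [<-|[xz yz]]; last by rewrite -ai_addA yz xz.
split; first by rewrite !ai_addA ai_addxx.
by rewrite !ai_addA (ai_addC y x) -(ai_addA x y y) ai_addxx.
Qed.

Let eq_le x y : (forall z, le x z <-> le y z) -> x = y.
Proof.
move=> xy; have /xy yx : le x x by exact: ai_addxx.
have /xy : le y y by exact: ai_addxx.
by rewrite /le => <-; rewrite ai_addC yx.
Qed.

Let le_sum (i : 'I_n) (F : 'I_n -> S) z :
  le (\big[@ai_add S/F i]_(k < n | k != i) F k) z <-> forall k, le (F k) z.
Proof.
split=> [+ k|Fz]; last by elim/big_ind: _ => // x y xz yz; exact/le_add.
have [->|ki] := eqVneq k i.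
  by elim/big_rec: _ => // j x _ IH /le_add[_ /IH].
rewrite -big_filter => sumz.
have : k \in [seq k <- index_enum 'I_n | k != i].
  by rewrite mem_filter ki mem_index_enum.
elim: [seq _ <- _ | _] sumz => // j s IH.
rewrite big_cons inE => /le_add[jz /IH{}IH] /orP[/eqP ->//|].
exact: IH.
Qed.

Let mulmx_le A B i j z :
  le (ai_mulmx A B i j) z <-> forall k, le (A i k * B k j) z.
Proof. by rewrite mxE (le_sum i (fun k => A i k * B k j)). Qed.

Let addmxA : associative ai_addmx.
Proof. by move=> A B C; apply/matrixP => i j; rewrite !mxE ai_addA. Qed.

Let addmxC : commutative ai_addmx.
Proof. by move=> A B; apply/matrixP => i j; rewrite !mxE ai_addC. Qed.

Let addmxx : idempotent_op ai_addmx.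
Proof. by move=> A; apply/matrixP => i j; rewrite !mxE ai_addxx. Qed.

Let mulmxA : associative ai_mulmx.
Proof.
move=> A B C; apply/matrixP => i j; apply: eq_le => z.
have mulL k : A i k * ai_mulmx B C k j =
    \big[@ai_add S/A i k * (B k k * C k j)]_(l < n | l != k)
      (A i k * (B k l * C l j)).
  by rewrite mxE (big_morph (ai_mul (A i k)) (ai_mulDr (A i k)) erefl).
have mulR k : ai_mulmx A B i k * C k j =
    \big[@ai_add S/(A i i * B i k) * C k j]_(l < n | l != i)
      ((A i l * B l k) * C k j).
  rewrite mxE (big_morph (ai_mul^~ (C k j)) (id1 := (A i i * B i k) * C k j)
    (op1 := @ai_add S)) // => x y.
  exact: ai_mulDl.
rewrite !mulmx_le; split=> H k.
  rewrite mulR (le_sum i (fun l => A i l * B l k * C k j)) => l.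
  have := H l; rewrite mulL.
  by move/(le_sum l (fun k => A i l * (B l k * C k j)))/(_ k); rewrite ai_mulA.
rewrite mulL (le_sum k (fun l => A i k * (B k l * C l j))) => l.
have := H l; rewrite mulR.
by move/(le_sum i (fun k => A i k * B k l * C l j))/(_ k); rewrite ai_mulA.
Qed.

Let mulmxDl : left_distributive ai_mulmx ai_addmx.
Proof.
move=> A B C; apply/matrixP => i j; apply: eq_le => z.
rewrite [ai_addmx (_ _ _) _ _ _]mxE le_add !mulmx_le.
split=> [H|[HA HB] k].
  by split=> k; have := H k; rewrite mxE ai_mulDl => /le_add[].
by rewrite mxE ai_mulDl; apply/le_add.
Qed.

Let mulmxDr : right_distributive ai_mulmx ai_addmx.
Proof.
move=> A B C; apply/matrixP => i j; apply: eq_le => z.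
rewrite [ai_addmx (_ _ _) _ _ _]mxE le_add !mulmx_le.
split=> [H|[HB HC] k].
  by split=> k; have := H k; rewrite mxE ai_mulDr => /le_add[].
by rewrite mxE ai_mulDr; apply/le_add.
Qed.

Let mx_nonempty : inhabited 'M[S]_n.
Proof. by case: (@ai_nonempty S) => x; exists; exact: const_mx x. Qed.

HB.instance Definition _ := isAiSemiring.Build 'M[S]_n mx_nonempty
  addmxA addmxC addmxx mulmxA mulmxDl mulmxDr.

End Matrix.

(* M_n(S) for n >= 1; the one-point algebra for n = 0.                        *)
Definition ai_mx (n : nat) (S : aiSemiringType) : aiSemiringType := 'M[S]_n.

Section Product.
Variables (I : Type) (F : I -> aiSemiringType).

Definition ai_prod_sort := forall i, F i.
Implicit Types f g : ai_prod_sort.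

Definition ai_prod_add f g : ai_prod_sort := fun i => f i + g i.
Definition ai_prod_mul f g : ai_prod_sort := fun i => f i * g i.

Let prod_nonempty : inhabited ai_prod_sort.
Proof. by exists => i; exact: inhabited_witness (@ai_nonempty (F i)). Qed.

Let prod_addA : associative ai_prod_add.
Proof.
by move=> f g h; apply: functional_extensionality_dep => i; exact: ai_addA.
Qed.

Let prod_addC : commutative ai_prod_add.
Proof. by move=> f g; apply: functional_extensionality_dep => i; exact: ai_addC. Qed.

Let prod_addxx : idempotent_op ai_prod_add.
Proof. by move=> f; apply: functional_extensionality_dep => i; exact: ai_addxx. Qed.

Let prod_mulA : associative ai_prod_mul.
Proof.
by move=> f g h; apply: functional_extensionality_dep => i; exact: ai_mulA.
Qed.

Let prod_mulDl : left_distributive ai_prod_mul ai_prod_add.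
Proof.
by move=> f g h; apply: functional_extensionality_dep => i; exact: ai_mulDl.
Qed.

Let prod_mulDr : right_distributive ai_prod_mul ai_prod_add.
Proof.
by move=> f g h; apply: functional_extensionality_dep => i; exact: ai_mulDr.
Qed.

HB.instance Definition _ := isAiSemiring.Build ai_prod_sort prod_nonempty
  prod_addA prod_addC prod_addxx prod_mulA prod_mulDl prod_mulDr.

Definition ai_prod : aiSemiringType := ai_prod_sort.

End Product.

Definition ai_class := aiSemiringType -> Prop.

Definition ai_class_eq (V W : ai_class) : Prop := forall S, V S <-> W S.
Notation "V =c W" := (ai_class_eq V W) (at level 70, no associativity).

(* Subalgebras are taken up to isomorphism, i.e. as injective homomorphisms.  *)
Record ai_variety (V : ai_class) : Prop := AiVariety {
  ai_variety_image : forall (S T : aiSemiringType) (f : S -> T),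
    ai_hom f -> (forall y, exists x, f x = y) -> V S -> V T;
  ai_variety_sub : forall (S T : aiSemiringType) (f : S -> T),
    ai_hom f -> injective f -> V T -> V S;
  ai_variety_prod : forall (I : Type) (F : I -> aiSemiringType),
    (forall i, V (F i)) -> V (ai_prod F)
}.

Definition ai_gen_variety (K : ai_class) : ai_class := fun S =>
  forall V : ai_class, ai_variety V -> (forall T, K T -> V T) -> V S.

Definition ai_mx_variety (n : nat) (V : ai_class) : ai_class :=
  ai_gen_variety (fun T => exists2 S, V S & T = ai_mx n S).

(* Main.v *)
Require Import Defs.
From mathcomp Require Import all_boot all_order all_algebra.
From mathcomp Require Import boolp.
From mathcomp Require Import zify.

Import Order.TTheory GRing.Theory Num.Theory.

Set Implicit Arguments.
Unset Strict Implicit.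
Unset Printing Implicit Defensive.

(** The chain is increasing on r >= 1: repeating rows and columns along a
    surjection of index sets embeds M_r(S) into M_s(S) for r <= s, idempotence
    of addition absorbing the repeated terms of each product
    ([expand_mx_hom]).  It is also compatible with scaling of indices: the
    operator M_k commutes with images, subalgebras and products, so the class
    of all T such that M_k(T) lies in a given variety is a variety
    ([mx_preimage_variety]); since M_k(M_r(S)) is M_(kr)(S)
    ([flatten_mx_hom]), the equality V_p = V_q gives V_(kp) = V_(kq)
    ([ai_mx_variety_scale]).

    Thus the chain is constant on each interval [kp, kq] with k >= 1.  When
    k(q - p) >= p, that is k >= r0, the interval [kp, kq] contains
    (k + 1)p, so consecutive intervals overlap and the chain is constant from
    r0 * p on ([increasing_scale_constant]). *)

(** * The natural order and products of matrices *)

Definition ai_le (S : aiSemiringType) (x z : S) : Prop := (x + z)%ai = z.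

Section Order.
Variable S : aiSemiringType.
Implicit Types x y z : S.

Lemma ai_lexx x : ai_le x x.
Proof. exact: ai_addxx. Qed.

Lemma ai_le_add x y z : ai_le (x + y)%ai z <-> ai_le x z /\ ai_le y z.
Proof.
rewrite /ai_le; split=> [<-|[xz yz]]; last by rewrite -ai_addA yz xz.
split; first by rewrite !ai_addA ai_addxx.
by rewrite ai_addA [(y + _)%ai]ai_addC -[(x + y + y)%ai]ai_addA ai_addxx.
Qed.

Lemma ai_eq_le x y : (forall z, ai_le x z <-> ai_le y z) -> x = y.
Proof.
move=> xy; have := (xy y).2 (ai_lexx y); have := (xy x).1 (ai_lexx x).
by rewrite /ai_le ai_addC => -> ->.
Qed.

(** The join of a nonempty finite family does not depend on the term at which
    the iteration starts, nor on repetitions; this form of the statement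
    forgets both. *)
Lemma ai_le_sum n (i : 'I_n) (F : 'I_n -> S) z :
  ai_le (\big[@ai_add S/F i]_(k < n | k != i) F k) z <->
  forall k, ai_le (F k) z.
Proof.
split=> [+ k|Fz]; last by elim/big_ind: _ => // x y xz yz; apply/ai_le_add.
have [->|ki] := eqVneq k i.
  by elim/big_rec: _ => // j x _ IH /ai_le_add[_ /IH].
rewrite -big_filter.
have : k \in [seq k <- index_enum 'I_n | k != i].
  by rewrite mem_filter ki mem_index_enum.
elim: [seq _ <- _ | _] => // j s IH; rewrite inE big_cons.
by move=> /orP[/eqP->|/IH{}IH] /ai_le_add[] // _ /IH.
Qed.

Lemma ai_addmxE n (A B : 'M[S]_n) i j : (A + B)%ai i j = (A i j + B i j)%ai.
Proof. by rewrite mxE. Qed.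

Lemma ai_mulmxE n (A B : 'M[S]_n) i j : (A * B)%ai i j =
  \big[@ai_add S/(A i i * B i j)%ai]_(k < n | k != i) (A i k * B k j)%ai.
Proof. by rewrite mxE. Qed.

Lemma ai_mulmx_le n (A B : 'M[S]_n) i j z :
  ai_le ((A * B)%ai i j) z <-> forall k, ai_le (A i k * B k j)%ai z.
Proof. by rewrite ai_mulmxE (ai_le_sum i (fun k => (A i k * B k j)%ai)). Qed.

End Order.

(** * Change of index set *)

Section Expand.
Variables (S : aiSemiringType) (r s : nat) (f : 'I_s -> 'I_r) (g : 'I_r -> 'I_s).
Hypothesis gK : cancel g f.

Definition expand_mx (A : ai_mx r S) : ai_mx s S :=
  (\matrix_(i, j) A (f i) (f j))%R.

(** Surjectivity of f makes every term of the product of A and B occur in the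
    product of the expanded matrices. *)
Lemma expand_mx_hom : ai_hom expand_mx.
Proof.
split=> A B; apply/matrixP => i j; first by rewrite ai_addmxE !mxE.
apply: ai_eq_le => z; rewrite [expand_mx (_ * _)%ai i j]mxE !ai_mulmx_le.
split=> H k; first by rewrite !mxE.
by have := H (g k); rewrite !mxE gK.
Qed.

Lemma expand_mx_inj : injective expand_mx.
Proof.
move=> A B /matrixP AB; apply/matrixP => i j.
by have := AB (g i) (g j); rewrite !mxE !gK.
Qed.

End Expand.

Section Flatten.
Variables (S : aiSemiringType) (m n : nat).

Definition block_index (k : 'I_(m * n)) : 'I_m * 'I_n :=
  enum_val (cast_ord (esym (mxvec_cast m n)) k).

Lemma mxvec_indexK i j : block_index (mxvec_index i j) = (i, j).
Proof. by rewrite /block_index cast_ordK enum_rankK. Qed.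

Lemma block_indexK k : mxvec_index (block_index k).1 (block_index k).2 = k.
Proof. by case/mxvec_indexP: k => i j; rewrite mxvec_indexK. Qed.

Definition flatten_mx (A : ai_mx m (ai_mx n S)) : ai_mx (m * n) S :=
  (\matrix_(k, l)
    A (block_index k).1 (block_index l).1 (block_index k).2 (block_index l).2)%R.

(** An entry of a product of block matrices is a join over blocks of joins
    within blocks, that is, a single join over all m * n indices. *)
Lemma flatten_mx_hom : ai_hom flatten_mx.
Proof.
split=> A B; apply/matrixP => k l; first by rewrite ai_addmxE !mxE.
apply: ai_eq_le => z; rewrite ai_mulmx_le mxE ai_mulmxE.
set i := (block_index k).1; set j := (block_index l).1.
set i' := (block_index k).2; set j' := (block_index l).2.
(* Reading off one entry of a sum of blocks is additive, so the join may be
   taken entrywise. *)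
rewrite (big_morph (fun M : ai_mx n S => M i' j')
  (fun M N => ai_addmxE M N i' j') erefl).
rewrite (ai_le_sum i (fun u => (A i u * B u j)%ai i' j')).
split=> [H w|H u]; first by have /ai_mulmx_le := H (block_index w).1; rewrite !mxE.
apply/ai_mulmx_le => u'.
by have := H (mxvec_index u u'); rewrite !mxE mxvec_indexK.
Qed.

Lemma flatten_mx_inj : injective flatten_mx.
Proof.
move=> A B /matrixP AB; apply/matrixP => i j; apply/matrixP => i' j'.
by have := AB (mxvec_index i i') (mxvec_index j j'); rewrite !mxE !mxvec_indexK.
Qed.

Lemma flatten_mx_surj B : exists A, flatten_mx A = B.
Proof.
exists (\matrix_(i, j) \matrix_(i', j')
  B (mxvec_index i i') (mxvec_index j j'))%R.
by apply/matrixP => k l; rewrite !mxE !block_indexK.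
Qed.

End Flatten.

(** * Matrices and the class operators *)

Section MapMatrix.
Variables (n : nat) (S T : aiSemiringType) (f : S -> T).
Hypothesis f_hom : ai_hom f.

Definition ai_map_mx (A : ai_mx n S) : ai_mx n T := map_mx f A.

Lemma ai_map_mx_hom : ai_hom ai_map_mx.
Proof.
have [fD fM] := f_hom.
split=> A B; apply/matrixP => i j; first by rewrite ai_addmxE !mxE fD.
rewrite ai_mulmxE [LHS]mxE ai_mulmxE (big_morph f fD erefl) !mxE fM.
by apply: eq_bigr => k _; rewrite !mxE fM.
Qed.

Lemma ai_map_mx_inj : injective f -> injective ai_map_mx.
Proof.
move=> f_inj A B /matrixP AB; apply/matrixP => i j.
by have := AB i j; rewrite !mxE => /f_inj.
Qed.

Lemma ai_map_mx_surj :
  (forall y, exists x, f x = y) -> forall B, exists A, ai_map_mx A = B.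
Proof.
move=> /choice[g gK] B; exists (map_mx g B).
by apply/matrixP => i j; rewrite !mxE gK.
Qed.

End MapMatrix.

Section ProdMatrix.
Variables (n : nat) (I : Type) (F : I -> aiSemiringType).

Definition mx_prod (A : ai_mx n (ai_prod F)) : ai_prod (fun i => ai_mx n (F i)) :=
  fun i => map_mx (fun x : ai_prod F => x i) A.

Lemma mx_prod_hom : ai_hom mx_prod.
Proof.
have proj_hom i : ai_hom (fun x : ai_prod F => x i) by [].
split=> A B; apply: functional_extensionality_dep => i.
  exact: (ai_map_mx_hom n (proj_hom i)).1.
exact: (ai_map_mx_hom n (proj_hom i)).2.
Qed.

Lemma mx_prod_inj : injective mx_prod.
Proof.
move=> A B AB; apply/matrixP => k l; apply: functional_extensionality_dep => i.
have /matrixP/(_ k l) : mx_prod A i = mx_prod B i by rewrite AB.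
by rewrite !mxE.
Qed.

End ProdMatrix.

(** An image, a subalgebra or a product turns, under M_n, into an image, a
    subalgebra or a subalgebra of a product respectively. *)
Lemma mx_preimage_variety n (W : ai_class) :
  ai_variety W -> ai_variety (fun T => W (ai_mx n T)).
Proof.
move=> [W_image W_sub W_prod]; split=> [S T f f_hom f_surj|S T f f_hom f_inj|I F].
- exact/W_image/ai_map_mx_surj/f_surj/ai_map_mx_hom.
- exact/W_sub/ai_map_mx_inj/f_inj/ai_map_mx_hom.
- by move=> /W_prod; exact/W_sub/mx_prod_inj/mx_prod_hom.
Qed.

(** * The chain of matrix varieties *)

Lemma ai_mx_variety_le (V : ai_class) r s (S : aiSemiringType) :
  0 < r -> r <= s -> ai_mx_variety r V S -> ai_mx_variety s V S.
Proof.
case: r => // r _ rs VrS W W_var WV; apply: VrS => // _ [T VT ->].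
have gK : cancel (widen_ord rs) (fun i : 'I_s => inord i : 'I_r.+1).
  by move=> i; rewrite inord_val.
apply: (ai_variety_sub W_var (expand_mx_hom T gK) (@expand_mx_inj T _ _ _ _ gK)).
by apply: WV; exists T.
Qed.

(** The class of all T with M_k(T) in a variety W that contains every M_(kr)(S)
    for S in V is a variety containing every M_r(S), hence all of the variety
    generated by them. *)
Lemma ai_mx_variety_mx (V : ai_class) k r (S : aiSemiringType) :
  ai_mx_variety r V S -> ai_mx_variety (k * r) V (ai_mx k S).
Proof.
move=> VrS W W_var WV.
apply: (VrS (fun T => W (ai_mx k T))); first exact: mx_preimage_variety.
move=> _ [T VT ->].
apply: (ai_variety_sub W_var (@flatten_mx_hom T k r)
  (@flatten_mx_inj T k r)).
by apply: WV; exists T.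
Qed.

(** M_(kp)(T) is an image of M_k(M_p(T)), and M_p(T) is in the variety of
    index q, which M_k sends into the variety of index kq. *)
Lemma ai_mx_variety_scale_sub (V : ai_class) k p q :
  (forall S, ai_mx_variety p V S -> ai_mx_variety q V S) ->
  forall S, ai_mx_variety (k * p) V S -> ai_mx_variety (k * q) V S.
Proof.
move=> pq S VkpS W W_var WV; apply: VkpS => // _ [T VT ->].
apply: (ai_variety_image W_var (@flatten_mx_hom T k p)
  (@flatten_mx_surj T k p)).
have VqT : ai_mx_variety q V (ai_mx p T).
  by apply: pq => X _ XV; apply: XV; exists T.
exact: ai_mx_variety_mx VqT _ W_var WV.
Qed.

Lemma ai_mx_variety_scale (V : ai_class) k p q :
  ai_mx_variety p V =c ai_mx_variety q V ->
  ai_mx_variety (k * p) V =c ai_mx_variety (k * q) V.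
Proof.
by move=> pq S; split; apply: ai_mx_variety_scale_sub => T /pq.
Qed.

(** Every s at least r0 * p lies between kp and (k + 1)p with k = s %/ p >= r0,
    and (k + 1)p <= kq; so U s is squeezed between U (kp) and U (kq), which are
    equal.  Taking s = (k + 1)p links consecutive multiples of p. *)
Lemma increasing_scale_constant (U : nat -> ai_class) p q r0 :
  (forall r s S, 0 < r -> r <= s -> U r S -> U s S) ->
  (forall k, U (k * p) =c U (k * q)) ->
  0 < p -> p <= r0 * (q - p) ->
  forall s, r0 * p <= s -> U s =c U (r0 * p).
Proof.
move=> U_le U_scale p_gt0 r0_ge.
have r0_gt0 : 0 < r0 by case: r0 r0_ge => // p0; lia.
have U_block k s : r0 <= k -> k * p <= s <= k.+1 * p -> U s =c U (k * p).
  move=> r0k /andP[kps skp] S.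
  have kp_gt0 : 0 < k * p by rewrite muln_gt0 p_gt0 (leq_trans r0_gt0).
  have skq : s <= k * q.
    have : r0 * (q - p) <= k * (q - p) by rewrite leq_mul2r r0k orbT.
    by nia.
  split; last exact: U_le.
  by move=> /(U_le _ _ _ (leq_trans kp_gt0 kps) skq)/U_scale.
have U_mul d : U ((r0 + d) * p) =c U (r0 * p).
  elim: d => [|d IHd] S; first by rewrite addn0.
  rewrite -IHd addnS -(U_block (r0 + d) ((r0 + d).+1 * p)) //.
    exact: leq_addr.
  by rewrite leqnn leq_mul2r leqnSn orbT.
move=> s r0s S.
have r0k : r0 <= s %/ p by rewrite leq_divRL.
rewrite (U_block (s %/ p)) // ?leq_trunc_div 1?ltnW ?ltn_ceil //.
by have := U_mul (s %/ p - r0) S; rewrite subnKC.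
Qed.

Lemma leq_ceil_div_mul (p d : nat) : 0 < d ->
  p <= `|Num.ceil (p%:R / d%:R : rat)%R|%N * d.
Proof.
move=> d_gt0; rewrite -(ler_nat rat) natrM -ler_pdivrMr ?ltr0n //.
rewrite natr_absz ger0_norm; first exact: Num.Theory.ceil_ge.
by rewrite -(ler_int rat); apply: le_trans (ceil_ge _); rewrite divr_ge0 ?ler0n.
Qed.

Theorem theorem9p5 (V : ai_class) (p q : nat)
    (Vr := fun r : nat => ai_mx_variety r V)
    (r0 := `|Num.ceil (p%:R / (q%:R - p%:R) : rat)%R|%N) :
  ai_variety V -> (1 <= p)%N -> (p < q)%N -> Vr p =c Vr q ->
  (exists N : nat, forall s t : nat, (1 <= s)%N -> (1 <= t)%N ->
     (N <= s)%N -> (N <= t)%N -> Vr s =c Vr t) /\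
  (forall s t : nat, (r0 * p <= s)%N -> (r0 * p <= t)%N -> Vr s =c Vr t).
Proof.
move=> _ p_gt0 pq Vpq.
have r0_ge : p <= r0 * (q - p).
  by rewrite /r0 -natrB ?leq_ceil_div_mul ?subn_gt0 // ltnW.
have Vr_const s : r0 * p <= s -> Vr s =c Vr (r0 * p).
  apply: increasing_scale_constant p_gt0 r0_ge s => [r s S|k].
    exact: ai_mx_variety_le.
  exact: ai_mx_variety_scale.
have Vr_eq s t : r0 * p <= s -> r0 * p <= t -> Vr s =c Vr t.
  by move=> s_ge t_ge S; rewrite Vr_const // Vr_const.
by split=> //; exists (r0 * p) => s t _ _; exact: Vr_eq.
Qed.
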